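(* Consider the heterogeneous bump regression (HBR) model with $|I_n|\searrow 0$ and the testing problem $H_0$ against $H_1^n$. Let $\varepsilon_n>0$ be any sequence such that $\varepsilon_n\sqrt{-\log(|I_n|)}\to\infty$ as $n\to\infty$, and let $\alpha\in(0,1)$ be a given significance level. Furthermore, let 1. either $\sigma_n^2/\Delta_n\to 0$ and $\sigma_n^2=o(\varepsilon_n)$, 2. or $\sigma_n^2/\Delta_n\to 0$ and $\sigma_n^2=\sigma^2(1+o(\varepsilon_n))$ for some constant $\sigma>0$, as $n\to\infty$. If $$\sqrt{n|I_n|}\,\Delta_n\succsim\left(\sqrt2\,\sigma_0+\varepsilon_n\right)\sqrt{-\log(|I_n|)},$$ then the likelihood ratio test $\Phi_n$, which rejects $H_0$ if and only if $T_n(Y)>c^*_{\alpha,n}$, satisfies $$\limsup_{n\to\infty}\bar\alpha(\Phi_n)\le\alpha\qquad\text{and}\qquad\limsup_{n\to\infty}\bar\beta(\Phi_n)\le\alpha.$$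
   Context: HBR model: for each $n$ one observes $Y=(Y_1,\dots,Y_n)$ with $Y_i=\mu_n(i/n)+\lambda_n(i/n)Z_i$, where $Z_1,\dots,Z_n$ are i.i.d. $\mathcal N(0,1)$. The parameters $\sigma_0>0$ (fixed), $\Delta_n>0$, $\sigma_n>0$ and $|I_n|\in(0,1]$ are known; put $\kappa_n=\sigma_n/\sigma_0$. It is assumed that $l_n:=1/|I_n|\in\mathbb N$ and $n|I_n|\in\mathbb N$, and $\mathcal A_n:=\{((j-1)|I_n|,\,j|I_n|] : 1\le j\le l_n\}$, so that each interval in $\mathcal A_n$ contains exactly $n|I_n|$ of the points $i/n$. The null hypothesis is $H_0:\ \mu_n\equiv 0,\ \lambda_n\equiv\sigma_0$; the alternative is $H_1^n:$ there is $I_n\in\mathcal A_n$ with $\mu_n=\Delta_n 1_{I_n}$ and $\lambda_n^2=\sigma_0^2+\sigma_n^2 1_{I_n}$ (the position of $I_n$ is unknown). For a test $\Phi_n:\mathbb R^n\to\{0,1\}$ (1 means reject $H_0$), the type I error is $\bar\alpha(\Phi_n)=\mathbb P_{H_0}(\Phi_n(Y)=1)$ and the type II error is $\bar\beta(\Phi_n)=\sup_{I_n\in\mathcal A_n}\mathbb P_{\mu_n=\Delta_n1_{I_n},\,\lambda_n^2=\sigma_0^2+\sigma_n^21_{I_n}}(\Phi_n(Y)=0)$. Test statistic: $$T_n(Y):=\sup_{I\in\mathcal A_n}\frac1{\sigma_0^2}\sum_{i:\,i/n\in I}\left(Y_i+\frac{\Delta_n}{\kappa_n^2}\right)^2.$$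 Threshold: $$c^*_{\alpha,n}=n|I_n|+\frac{n|I_n|\Delta_n^2}{\sigma_0^2\kappa_n^4}-2\log(\alpha|I_n|)+2\sqrt{n|I_n|\left(1+2\frac{\Delta_n^2}{\sigma_0^2\kappa_n^4}\right)\log\left(\frac1{\alpha|I_n|}\right)}.$$ Notation: $a_n\succsim b_n$ means there is $N\in\mathbb N$ such that $a_n\ge b_n$ for all $n\ge N$. *)

(* Defs.v *)
From HB Require Import structures.
From mathcomp Require Import all_boot all_order all_algebra.
From mathcomp Require Import all_classical all_reals all_analysis.
Import Order.TTheory GRing.Theory Num.Theory.
Import numFieldNormedType.Exports.

Set Implicit Arguments.
Unset Strict Implicit.
Unset Printing Implicit Defensive.

Local Open Scope classical_set_scope.
Local Open Scope ring_scope.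

(* Observations are indexed by ['I_n]; the index [i] (counted from 0) stands
   for observation number [i.+1], located at the point (i+1)/n. *)
Definition design_point (R : realType) (n : nat) (i : 'I_n) : R :=
  i.+1%:R / n%:R.

(* The Borel-set product rule for every subfamily; independence of the
   components is not provided by the library. *)
Definition mutually_independent (d : measure_display) (T : measurableType d)
    (R : realType) (P : probability T R) (n : nat)
    (X : 'I_n -> {RV P >-> R}) : Prop :=
  forall (J : {set 'I_n}) (B : 'I_n -> set R),
    (forall i, measurable (B i)) ->
    P (\bigcap_(i in [set` J]) (X i @^-1` B i)) =
    (\prod_(i in J) P (X i @^-1` B i))%E.

Definition iid_std_normal (d : measure_display) (T : measurableType d)
    (R : realType) (P : probability T R) (n : nat)
    (Z : 'I_n -> {RV P >-> R}) : Prop :=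
  mutually_independent Z /\
  forall (i : 'I_n) (A : set R), measurable A ->
    distribution P (Z i) A = normal_prob 0 1 A.

Definition hbr_obs (d : measure_display) (T : measurableType d)
    (R : realType) (P : probability T R) (n : nat)
    (Z : 'I_n -> {RV P >-> R}) (mu lambda : R -> R) (w : T) : 'I_n -> R :=
  fun i => mu (design_point R i) + lambda (design_point R i) * Z i w.

(* With [len] = |I_n|, the bound j <= l_n = 1/|I_n| is [j%:R <= len^-1]. *)
Definition candidate_intervals (R : realType) (len : R) : set (set R) :=
  [set I | exists j : nat, [/\ (1 <= j)%N, j%:R <= len^-1 &
    I = `](j.-1%:R * len), (j%:R * len)]%classic]].

Definition mu0 (R : realType) : R -> R := fun=> 0.

Definition lambda0 (R : realType) (sigma0 : R) : R -> R := fun=> sigma0.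

Definition mu1 (R : realType) (Delta : R) (I : set R) : R -> R :=
  fun x => Delta * \1_I x.

Definition lambda1 (R : realType) (sigma0 sigma : R) (I : set R) : R -> R :=
  fun x => Num.sqrt (sigma0 ^+ 2 + sigma ^+ 2 * \1_I x).

(* A test is a map ('I_n -> R) -> bool, where [true] means: reject H_0. *)
Definition type1_error (d : measure_display) (T : measurableType d)
    (R : realType) (P : probability T R) (n : nat)
    (Z : 'I_n -> {RV P >-> R}) (sigma0 : R)
    (Phi : ('I_n -> R) -> bool) : \bar R :=
  P [set w | Phi (hbr_obs Z (@mu0 R) (lambda0 sigma0) w) = true].

Definition type2_error (d : measure_display) (T : measurableType d)
    (R : realType) (P : probability T R) (n : nat)
    (Z : 'I_n -> {RV P >-> R}) (sigma0 Delta sigma len : R)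
    (Phi : ('I_n -> R) -> bool) : \bar R :=
  ereal_sup [set P [set w |
      Phi (hbr_obs Z (mu1 Delta I) (lambda1 sigma0 sigma I) w) = false]
    | I in candidate_intervals len].

Definition scan_statistic (R : realType) (n : nat)
    (sigma0 Delta sigma len : R) (y : 'I_n -> R) : R :=
  let kappa := sigma / sigma0 in
  sup [set (sigma0 ^+ 2)^-1 *
        \sum_(i < n | design_point R i \in I) (y i + Delta / kappa ^+ 2) ^+ 2
      | I in candidate_intervals len].

Definition threshold (R : realType) (n : nat)
    (sigma0 Delta sigma len alpha : R) : R :=
  let kappa := sigma / sigma0 in
  n%:R * len
  + n%:R * len * Delta ^+ 2 / (sigma0 ^+ 2 * kappa ^+ 4)
  - 2 * ln (alpha * len)
  + 2 * Num.sqrt (n%:R * len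
                  * (1 + 2 * (Delta ^+ 2 / (sigma0 ^+ 2 * kappa ^+ 4)))
                  * ln (1 / (alpha * len))).

Definition lr_test (R : realType) (n : nat)
    (sigma0 Delta sigma len alpha : R) (y : 'I_n -> R) : bool :=
  threshold n sigma0 Delta sigma len alpha
    < scan_statistic sigma0 Delta sigma len y.

(* Main.v *)
Require Import Defs.
From mathcomp Require Import all_boot all_order all_algebra.
From mathcomp Require Import all_classical all_reals all_analysis.
From mathcomp Require Import measurable_realfun.
From mathcomp Require Import ring lra.
Import Order.TTheory GRing.Theory Num.Theory.
Import numFieldNormedType.Exports.
Import HBNNSimple.

Local Open Scope classical_set_scope.
Local Open Scope ring_scope.

(** Under either hypothesis the statistic of one candidate interval is, up to a
known factor, a noncentral chi-square variable: a sum of m = n|I_n| squares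
(Z_i + b)^2, where b = a := Delta sigma0 / sigma^2 under the null hypothesis
and b^2 = a^2 (1 + k), with factor 1 + k, k := sigma^2 / sigma0^2, on the
interval that carries the bump. Chernoff's method gives for such a sum,
whose mean is m (1 + b^2), the two-sided deviation bounds
[noncentral_chi2_upper_tail] and [noncentral_chi2_lower_tail]: with
v = m (1 + 2 b^2), the sum exceeds its mean by 2 sqrt (v x) + 2 x, or falls
short of it by 2 sqrt (v x), with probability at most exp (- x) each.

The threshold is exactly the upper deviation for exp (- x) = alpha |I_n|, so a
union bound over the 1 / |I_n| candidates bounds the type I error by alpha
([type1_error_le]).

For the type II error it suffices to look at the interval that carries the
bump. The lower deviation with exp (- x) = alpha gives an error of at most alpha
as soon as (1 + k) times the lower deviation point lies above the threshold
([type2_error_le]). Putting u = sqrt m, y = sqrt (- ln (alpha |I_n|)) and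
z = sqrt (- ln alpha), the comparison reduces to
u a k >= sqrt 2 y + 2 z (1 + k) ([power_margin]), where
u a k = sqrt m Delta / sigma0 is the quantity that the detection condition
controls. That condition provides sqrt 2 sqrt (- ln |I_n|) plus a margin
eps_n sqrt (- ln |I_n|) / sigma0 tending to infinity, which absorbs the
bounded difference of the square roots, and also 2 z k, because both regimes
force k = O(1 + eps_n) ([detection_margin]).

The moment generating function of the sum factorizes by independence, which
is given for Borel sets; [mutually_independent_integral_prod] lifts it to
products of nonnegative functions. *)

(** * Integrals against weights and independence *)

Lemma weighted_integral_nnsfun (d d' : measure_display) (T : measurableType d)
    (Y : measurableType d') (R : realType) (mu : {measure set T -> \bar R})
    (X : T -> Y) (W : T -> R) (g : {nnsfun Y >-> R}) :
  measurable_fun setT X -> measurable_fun setT W -> (forall x, 0 <= W x) ->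
  (\int[mu]_x (g (X x) * W x)%:E =
   \sum_(r \in range g)
      r%:E * \int[mu]_x (\1_(g @^-1` [set r]) (X x) * W x)%:E)%E.
Proof.
move=> mX mW W0.
have mI r : measurable_fun setT
    (fun x => (\1_(g @^-1` [set r]) (X x) * W x)%:E).
  apply/measurable_EFinP/measurable_funM => //.
  exact: (measurableT_comp (measurable_indic _) mX).
under eq_integral => x _.
  rewrite fimfunE EFinM -fsumEFin// ge0_mule_fsuml; last first.
    by move=> r; rewrite nnfun_muleindic_ge0.
  under eq_fsbigr => r _ do rewrite EFinM -muleA -EFinM.
  over.
rewrite ge0_integral_fsum//.
- apply: eq_fsbigr => r /set_mem [y _ <-].
  under eq_integral do rewrite EFinM.
  by rewrite ge0_integralZl// => [x _|]; rewrite lee_fin// mulr_ge0.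
- move=> r; under eq_fun do rewrite EFinM.
  exact: emeasurable_funM.
- move=> r x _; rewrite mulrA EFinM mule_ge0//; last by rewrite lee_fin.
  by rewrite nnfun_muleindic_ge0.
Qed.

(** Two weighted images of measures that agree on indicators agree on all
    nonnegative functions. Allowing different spaces and weights on the two
    sides makes one statement serve both for independence, where the weights
    are the product of the other factors and its mean, and for the normal
    law, where the weight on the right is the density. *)
Lemma eq_weighted_integral (d1 d2 d' : measure_display)
    (T1 : measurableType d1) (T2 : measurableType d2) (Y : measurableType d')
    (R : realType) (mu1 : {measure set T1 -> \bar R})
    (mu2 : {measure set T2 -> \bar R}) (X1 : T1 -> Y) (X2 : T2 -> Y)
    (W1 : T1 -> R) (W2 : T2 -> R) (f : Y -> R) :
  measurable_fun setT X1 -> measurable_fun setT X2 ->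
  measurable_fun setT W1 -> measurable_fun setT W2 ->
  (forall x, 0 <= W1 x) -> (forall x, 0 <= W2 x) ->
  (forall B, measurable B ->
    \int[mu1]_x (\1_B (X1 x) * W1 x)%:E =
    \int[mu2]_x (\1_B (X2 x) * W2 x)%:E)%E ->
  measurable_fun setT f -> (forall y, 0 <= f y) ->
  (\int[mu1]_x (f (X1 x) * W1 x)%:E = \int[mu2]_x (f (X2 x) * W2 x)%:E)%E.
Proof.
move=> mX1 mX2 mW1 mW2 W10 W20 H mf f0.
have mEf : measurable_fun setT (EFin \o f) by exact/measurable_EFinP.
pose g := nnsfun_approx measurableT mEf.
have lim_g (d : measure_display) (T : measurableType d)
    (mu : {measure set T -> \bar R}) (X : T -> Y) (W : T -> R) :
    measurable_fun setT X -> measurable_fun setT W -> (forall x, 0 <= W x) ->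
    (\int[mu]_x (f (X x) * W x)%:E =
     limn (fun n => \int[mu]_x (g n (X x) * W x)%:E))%E.
  move=> mX mW W0; rewrite -monotone_convergence//.
  - apply: eq_integral => x _; apply/esym/cvg_lim => //.
    rewrite EFinM; under eq_fun do rewrite EFinM.
    apply: cvgeZr => //.
    apply: (@cvg_nnsfun_approx _ _ _ _ measurableT _ mEf) => // y _.
    by rewrite lee_fin.
  - move=> n; apply/measurable_EFinP/measurable_funM => //.
    exact: measurableT_comp.
  - by move=> n x _; rewrite lee_fin mulr_ge0.
  - move=> x _ m n mn; rewrite lee_fin ler_wpM2r//.
    exact/lefP/nd_nnsfun_approx.
rewrite !lim_g//; congr (limn _); apply/funext => n.
rewrite !weighted_integral_nnsfun//; apply: eq_fsbigr => r _.
by rewrite H.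
Qed.

(** Indicators are replaced by arbitrary functions one coordinate at a time:
    the coordinates outside the list [s] still carry indicators, and when [k]
    joins the list both sides are integrals of [f k] for weights that agree on
    indicators, by the induction hypothesis. Finiteness of the means keeps the
    weight on the right-hand side real. *)
Lemma mutually_independent_integral_prod (d : measure_display)
    (T : measurableType d) (R : realType) (P : probability T R) (n : nat)
    (X : 'I_n -> {RV P >-> R}) (f : 'I_n -> R -> R) :
  mutually_independent X ->
  (forall i, measurable_fun setT (f i)) -> (forall i x, 0 <= f i x) ->
  (forall i, \int[P]_w (f i (X i w))%:E < +oo)%E ->
  (\int[P]_w (\prod_(i < n) f i (X i w))%:E =
   \prod_(i < n) \int[P]_w (f i (X i w))%:E)%E.
Proof.
move=> indep.
have mX i : measurable_fun setT (X i) by exact: measurable_funPT.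
have mXB i B : measurable B -> measurable (X i @^-1` B).
  by move=> mB; rewrite -[_ @^-1` _]setTI; exact: mX.
have intB i B : measurable B ->
    (\int[P]_w (\1_B (X i w))%:E = P (X i @^-1` B))%E.
  move=> mB; transitivity (\int[P]_w (\1_(X i @^-1` B) w)%:E)%E => //.
  by rewrite integral_indic ?setIT//; exact: mXB.
suff ind (s : seq 'I_n) : forall f : 'I_n -> R -> R,
    (forall i, measurable_fun setT (f i)) -> (forall i x, 0 <= f i x) ->
    (forall i, \int[P]_w (f i (X i w))%:E < +oo)%E ->
    (forall i, i \notin s -> exists2 B, measurable B & f i = \1_B) ->
    (\int[P]_w (\prod_(i < n) f i (X i w))%:E =
     \prod_(i < n) \int[P]_w (f i (X i w))%:E)%E.
  move=> mf f0 foo; apply: (ind (enum 'I_n)) => // i.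
  by rewrite mem_enum.
elim: s => [|k s IH] {}f mf f0 foo fB.
  have /choice [B HB] : forall i, exists B, measurable B /\ f i = \1_B.
    by move=> i; have [//|B mB fE] := fB i; exists B.
  have := indep [set: 'I_n]%SET B (fun i => (HB i).1).
  rewrite [RHS](eq_bigl xpredT) => [|i]; last by rewrite finset.in_setT.
  have -> : (\prod_(i < n) P (X i @^-1` B i) =
             \prod_(i < n) \int[P]_w (f i (X i w))%:E)%E.
    by apply: eq_bigr => i _; rewrite (HB i).2 intB//; exact: (HB i).1.
  move=> <-; set A := (X in P X); have mA : measurable A.
    apply: fin_bigcap_measurable => // i _; exact: (mXB _ _ (HB i).1).
  transitivity (\int[P]_w (\1_A w)%:E)%E; last by rewrite integral_indic// setIT.
  apply: eq_integral => w _; congr _%:E; rewrite indicE.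
  have [wA|wA] := boolP (w \in A).
    rewrite big1// => i _; rewrite (HB i).2 indicE mem_set//.
    by move/set_mem : wA; apply => /=; rewrite finset.in_setT.
  suff [i wBi] : exists i, ~ B i (X i w).
    by rewrite (bigD1 i)//= (HB i).2 indicE memNset// mul0r.
  apply: contrapT => /forallNP H; move/negP : wA; apply; apply: mem_set.
  by move=> i _; apply: contrapT; exact: H.
pose W w := \prod_(i < n | i != k) f i (X i w).
pose c := fine (\prod_(i < n | i != k) \int[P]_w (f i (X i w))%:E)%E.
have cE : (c%:E = \prod_(i < n | i != k) \int[P]_w (f i (X i w))%:E)%E.
  rewrite fineK//; apply: (big_ind (fun x => x \is a fin_num)) => // [x y|i _].
    exact: fin_numM.
  rewrite ge0_fin_numE//; apply: integral_ge0 => w _; exact: f0.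
have c0 : 0 <= c.
  rewrite -lee_fin cE; apply: (big_ind (fun x => 0 <= x)%E) => // [x y|i _].
    exact: mule_ge0.
  by apply: integral_ge0 => w _; exact: f0.
have W0 w : 0 <= W w by apply: prodr_ge0 => i _; exact: f0.
have mW : measurable_fun setT W.
  rewrite (_ : W = fun w => \prod_(i < n) (if i != k then f i (X i w) else 1)).
    apply: measurable_prod => i _; case: (i != k) => //.
    exact: measurableT_comp.
  by apply/funext => w; rewrite /W big_mkcond.
transitivity (\int[P]_w (f k (X k w) * W w)%:E)%E.
  by apply: eq_integral => w _; rewrite (bigD1 k)//=.
rewrite [RHS](bigD1 k)//= -cE.
transitivity (\int[P]_w (f k (X k w) * c)%:E)%E; last first.
  under eq_integral do rewrite EFinM.
  rewrite ge0_integralZr//.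
  - exact/measurable_EFinP/measurableT_comp.
  - by move=> w _; exact: f0.
apply: (@eq_weighted_integral _ _ _ _ _ _ _ P P) => //.
move=> B mB.
pose f' i := if i == k then \1_B else f i.
have f'k : f' k = \1_B by rewrite /f' eqxx.
have f'N i : i != k -> f' i = f i by rewrite /f' => /negbTE ->.
transitivity (\int[P]_w (\prod_(i < n) f' i (X i w))%:E)%E.
  apply: eq_integral => w _; rewrite [in RHS](bigD1 k)//= f'k.
  by congr (_ * _)%:E; apply: eq_bigr => i /f'N ->.
rewrite IH.
- rewrite (bigD1 k)//= f'k.
  rewrite (eq_bigr (fun i => \int[P]_w (f i (X i w))%:E)%E); last first.
    by move=> i ik; rewrite f'N.
  rewrite -cE; under [in RHS]eq_integral do rewrite EFinM.
  rewrite ge0_integralZr//.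
  apply/measurable_EFinP.
  exact: (measurableT_comp (measurable_indic _) (mX k)).
- by move=> i; rewrite /f'; case: eqP => // _; exact: measurable_indic.
- by move=> i x; rewrite /f'; case: eqP.
- move=> i; rewrite /f'; case: eqP => // _.
  by rewrite intB// (le_lt_trans (probability_le1 _ _)) ?ltry//; exact: mXB.
- move=> i; rewrite /f'; case: eqP => [_ _|/eqP ik]; first by exists B.
  by move=> si; apply: fB; rewrite inE negb_or ik.
Qed.

(** * Squares of shifted standard normal variables *)

Lemma ln1Dx_ge (R : realType) (y : R) : 0 <= y -> y - y ^+ 2 / 2 <= ln (1 + y).
Proof.
move=> y0.
pose f := fun x : R => ln (1 + x) - x + x ^+ 2 / 2.
have df (x : R) : -1 < x -> is_derive x 1 f ((1 + x)^-1 - 1 + x).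
  move=> x1.
  have : is_derive (1 + x) 1 (@ln R) (1 + x)^-1 by apply: is_derive1_ln; lra.
  move=> H; rewrite /f.
  apply: is_derive_eq.
  by rewrite !scaler1 /= /GRing.scale/=; field; lra.
suff : f 0 <= f y by rewrite /f addr0 ln1 expr0n/= mul0r; lra.
apply: (@ger0_derive1_ndecry _ f 0) => // [x|x|].
- by rewrite in_itv/= andbT => x0; have := df x ltac:(lra) => -[].
- rewrite in_itv/= andbT => x0; rewrite derive1E.
  have -> := @derive_val _ _ _ _ _ _ _ (df x ltac:(lra)).
  suff -> : (1 + x)^-1 - 1 + x = x ^+ 2 / (1 + x).
    by rewrite divr_ge0 ?sqr_ge0//; lra.
  by field; lra.
- apply: derivable_within_continuous => x; rewrite in_itv/= andbT => x0.
  by have := df x ltac:(lra) => -[].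
Qed.

Lemma lnV_le (R : realType) (y : R) : 0 < y <= 1 -> - ln y <= (y^-1 - y) / 2.
Proof.
move=> /andP[y0 y1].
pose f := fun x : R => ln x + (x^-1 - x) / 2.
have df (x : R) : 0 < x -> is_derive x 1 f (x^-1 + (- x ^- 2 - 1) / 2).
  move=> x0; have H : is_derive x 1 (@ln R) x^-1 by exact: is_derive1_ln.
  have H' : is_derive x 1 (@GRing.inv R) (- x ^- 2).
    by apply: is_derive_eq; [apply: is_deriveV; rewrite gt_eqF|rewrite /GRing.scale/= mulr1].
  rewrite /f; apply: is_derive_eq.
  by rewrite /GRing.scale/= !mulr0 add0r [_ / 2]mulrC.
suff : f 1 <= f y by rewrite /f ln1 invr1 subrr mul0r; lra.
have gt0 (x : R) : x \in `]y, 1[ -> 0 < x.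
  by rewrite in_itv/= => /andP[yx _]; lra.
apply: (@ler0_derive1_nincr _ f y 1) => // [x /gt0 x0|x /gt0 x0|].
- by have := df x x0 => -[].
- rewrite derive1E; have -> := @derive_val _ _ _ _ _ _ _ (df x x0).
  suff -> : x^-1 + (- x ^- 2 - 1) / 2 = - ((x^-1 - 1) ^+ 2 / 2).
    by rewrite oppr_le0 divr_ge0 ?sqr_ge0.
  by field; lra.
- apply: derivable_within_continuous => x; rewrite in_itv/= => /andP[yx _].
  by have := df x ltac:(lra) => -[].
Qed.

(** Turns a logarithmic inequality into a bound on the normalizing factor
    (1 - 2 t)^(-1/2) of the chi-square moment generating function. *)
Lemma sqrtV_le_expR (R : realType) (w e : R) :
  0 < w -> - ln w <= 2 * e -> Num.sqrt w^-1 <= expR e.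
Proof.
move=> w0 H; rewrite -(ler_pXn2r (n:=2))// ?nnegrE ?expR_ge0 ?sqrtr_ge0//.
rewrite sqr_sqrtr ?invr_ge0 ?(ltW w0)//.
by rewrite -expRM_natl -[leLHS]lnK ?posrE ?invr_gt0// ler_expR lnV ?posrE.
Qed.

(** With w = 1 - 2 t, the exponent 2 (t + t^2 / (1 - 2 t)) equals
    (w^-1 - w) / 2, so [lnV_le] bounds the square root; the exponential factor
    is rewritten exactly. *)
Lemma sqr_mgf_upper (R : realType) (t b : R) : 0 <= t < 2^-1 ->
  Num.sqrt (1 - 2 * t)^-1 * expR (t * b ^+ 2 / (1 - 2 * t)) <=
  expR (t * (1 + b ^+ 2) + (1 + 2 * b ^+ 2) * (t ^+ 2 / (1 - 2 * t))).
Proof.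
move=> /andP[t0 t2].
have -> : t * (1 + b ^+ 2) + (1 + 2 * b ^+ 2) * (t ^+ 2 / (1 - 2 * t)) =
    (t + t ^+ 2 / (1 - 2 * t)) + t * b ^+ 2 / (1 - 2 * t) by field; lra.
rewrite expRD ler_wpM2r ?expR_ge0// sqrtV_le_expR//; first lra.
apply: (le_trans (@lnV_le _ _ _)); first by apply/andP; split; lra.
by rewrite le_eqVlt; apply/orP; left; apply/eqP; field; lra.
Qed.

(** Since 1 / (1 + 2 r) >= 1 - 2 r, the quadratic term carries no denominator
    for negative arguments; this is why the lower deviation has no linear
    term. *)
Lemma sqr_mgf_lower (R : realType) (r b : R) : 0 <= r ->
  Num.sqrt (1 - 2 * (- r))^-1 * expR (- r * b ^+ 2 / (1 - 2 * (- r))) <=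
  expR (- r * (1 + b ^+ 2) + (1 + 2 * b ^+ 2) * r ^+ 2).
Proof.
move=> r0.
have -> : - r * (1 + b ^+ 2) + (1 + 2 * b ^+ 2) * r ^+ 2 =
    (- r + r ^+ 2) + (- r * b ^+ 2 + 2 * b ^+ 2 * r ^+ 2) by ring.
rewrite expRD ler_pM ?sqrtr_ge0 ?expR_ge0//.
  apply: sqrtV_le_expR; first lra.
  have := @ln1Dx_ge _ (2 * r) ltac:(lra).
  have -> : 1 - 2 * - r = 1 + 2 * r by ring.
  by lra.
rewrite ler_expR ler_pdivrMr; last lra.
rewrite -subr_ge0.
have -> : (- r * b ^+ 2 + 2 * b ^+ 2 * r ^+ 2) * (1 - 2 * - r) - - r * b ^+ 2
  = 4 * (r * (r * b) ^+ 2) by ring.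
by apply: mulr_ge0 => //; apply: mulr_ge0 => //; exact: sqr_ge0.
Qed.

(** Completing the square: tilting the standard normal density by
    exp (t (x + b)^2) gives a multiple of a normal density of variance
    1 / (1 - 2 t). *)
Lemma expR_sqr_normal_pdf (R : realType) (t b x : R) : t < 2^-1 ->
  let s := Num.sqrt (1 - 2 * t)^-1 in
  expR (t * (x + b) ^+ 2) * normal_pdf 0 1 x =
  s * expR (t * b ^+ 2 / (1 - 2 * t)) * normal_pdf (2 * t * b / (1 - 2 * t)) s x.
Proof.
move=> t2 s.
have w0 : 0 < 1 - 2 * t by lra.
have s0 : 0 < s by rewrite sqrtr_gt0 invr_gt0.
have sE : s ^+ 2 = (1 - 2 * t)^-1 by rewrite sqr_sqrtr// invr_ge0 ltW.
rewrite !normal_pdfE ?gt_eqF// /normal_peak /normal_fun.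
have -> : Num.sqrt (s ^+ 2 * pi *+ 2) = s * Num.sqrt (1 ^+ 2 * pi *+ 2).
  rewrite -[in RHS](gtr0_norm s0) -sqrtr_sqr -sqrtrM ?sqr_ge0//.
  by congr (Num.sqrt _); ring.
set c := Num.sqrt (1 ^+ 2 * pi *+ 2).
have c0 : c != 0.
  by rewrite gt_eqF// sqrtr_gt0 expr1n mul1r mulrn_wgt0// pi_gt0.
have s0' : s != 0 by rewrite gt_eqF.
transitivity (c^-1 * expR (t * b ^+ 2 / (1 - 2 * t)
   + - (x - 2 * t * b / (1 - 2 * t)) ^+ 2 / (s ^+ 2 *+ 2))); last first.
  rewrite expRD; set e1 := expR _; set e2 := expR _.
  by field; rewrite c0 s0'.
rewrite mulrCA -expRD; congr (_ * expR _).
by rewrite sE; field; lra.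
Qed.

Lemma std_normal_integral (d : measure_display) (T : measurableType d)
    (R : realType) (P : probability T R) (X : {RV P >-> R}) (f : R -> R) :
  (forall A, measurable A -> distribution P X A = normal_prob 0 1 A) ->
  measurable_fun setT f -> (forall x, 0 <= f x) ->
  (\int[P]_w (f (X w))%:E =
   \int[lebesgue_measure]_x (f x * normal_pdf 0 1 x)%:E)%E.
Proof.
move=> XN mf f0; transitivity (\int[P]_w (f (X w) * 1)%:E)%E.
  by apply: eq_integral => w _; rewrite mulr1.
have mX : measurable_fun setT X by exact: measurable_funPT.
apply: (@eq_weighted_integral _ _ _ _ _ _ _ P lebesgue_measure X idfun (cst 1)) => //.
- exact: measurable_id.
- exact: measurable_normal_pdf.
- by move=> x; exact: normal_pdf_ge0.
move=> B mB; transitivity (P (X @^-1` B)).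
  transitivity (\int[P]_w (\1_(X @^-1` B) w)%:E)%E.
    by apply: eq_integral => w _; rewrite mulr1.
  by rewrite integral_indic ?setIT// -[_ @^-1` _]setTI; exact: mX.
transitivity (normal_prob 0 1 B) => //; first by rewrite -XN.
rewrite /normal_prob [LHS]integral_mkcond.
apply: eq_integral => x _.
rewrite patchE indicE/=; case: ifPn => _; first by rewrite mul1r.
by rewrite mul0r.
Qed.

Lemma measurable_expR_sqr (R : realType) (t b : R) :
  measurable_fun setT (fun x : R => expR (t * (x + b) ^+ 2)).
Proof.
apply: measurableT_comp => //; apply: measurable_funM => //.
by apply: measurable_funX; exact: measurable_funD.
Qed.

Lemma std_normal_sqr_mgf (d : measure_display) (T : measurableType d)
    (R : realType) (P : probability T R) (X : {RV P >-> R}) (t b : R) :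
  (forall A, measurable A -> distribution P X A = normal_prob 0 1 A) ->
  t < 2^-1 ->
  (\int[P]_w (expR (t * (X w + b) ^+ 2))%:E =
   (Num.sqrt (1 - 2 * t)^-1 * expR (t * b ^+ 2 / (1 - 2 * t)))%:E)%E.
Proof.
move=> XN t2.
have mf := measurable_expR_sqr R t b.
rewrite (@std_normal_integral _ _ _ _ X (fun x => expR (t * (x + b) ^+ 2)))//.
under eq_integral do rewrite expR_sqr_normal_pdf// EFinM.
rewrite ge0_integralZl//.
- by rewrite integral_normal_pdf mule1.
- by apply/measurable_EFinP; exact: measurable_normal_pdf.
- by move=> x _; rewrite lee_fin normal_pdf_ge0.
Qed.

(** Exponential Markov inequality for either sign of [t]; [e] is any bound on
    the logarithm of the moment generating function of a single square. *)
Lemma chernoff_sum_sqr (d : measure_display) (T : measurableType d)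
    (R : realType) (P : probability T R) (n : nat) (Z : 'I_n -> {RV P >-> R})
    (J : pred 'I_n) (t b c e : R) (A : set T) :
  iid_std_normal Z -> t < 2^-1 ->
  Num.sqrt (1 - 2 * t)^-1 * expR (t * b ^+ 2 / (1 - 2 * t)) <= expR e ->
  measurable A ->
  (forall w, A w -> c <= t * \sum_(i < n | J i) (Z i w + b) ^+ 2) ->
  (P A <= (expR (#|J|%:R * e - c))%:E)%E.
Proof.
move=> [indep ZN] t2 He mA HA.
pose f (i : 'I_n) x : R := if J i then expR (t * (x + b) ^+ 2) else 1.
have mf i : measurable_fun setT (f i).
  by rewrite /f; case: (J i) => //; exact: measurable_expR_sqr.
have f0 i x : 0 <= f i x by rewrite /f; case: (J i); rewrite ?expR_ge0.
have If i : (\int[P]_w (f i (Z i w))%:E <= (if J i then expR e else 1)%:E)%E.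
  rewrite /f; case: (J i).
    rewrite (@std_normal_sqr_mgf _ _ _ _ (Z i) t b) ?lee_fin//.
    exact: ZN.
  by rewrite integral_cst// mul1e probability_le1.
have prodE w : \prod_(i < n) f i (Z i w)
    = expR (t * \sum_(i < n | J i) (Z i w + b) ^+ 2).
  by rewrite mulr_sumr expR_sum [RHS]big_mkcond.
have mZ i : measurable_fun setT (Z i) by exact: measurable_funPT.
have mprod : measurable_fun setT (fun w => \prod_(i < n) f i (Z i w)).
  apply: measurable_prod => i _; exact: measurableT_comp.
have -> : P A = (\int[P]_w (\1_A w)%:E)%E by rewrite integral_indic// setIT.
apply: (@le_trans _ _ (\int[P]_w ((expR (- c))%:E * (\prod_(i < n) f i (Z i w))%:E))%E).
  apply: ge0_le_integral => //.
  - by apply/measurable_EFinP; exact: measurable_indic.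
  - by apply: emeasurable_funM => //; apply/measurable_EFinP.
  - move=> w _; rewrite prodE -EFinM -expRD lee_fin indicE.
    have [/set_mem/HA H|_] := boolP (w \in A); last by rewrite expR_ge0.
    by rewrite /= -expR0 ler_expR; lra.
rewrite ge0_integralZl//.
- rewrite mutually_independent_integral_prod//; last first.
    by move=> i; rewrite (le_lt_trans (If i))// ltry.
  rewrite [_ - c]addrC expRD EFinM lee_pmul2l ?lte_fin ?expR_gt0//.
  have -> : expR (#|J|%:R * e) = \prod_(i < n) (if J i then expR e else 1).
    by rewrite -big_mkcond/= prodr_const expRM_natl.
  rewrite -prodEFin.
  (* Products of extended reals are monotone only together with positivity. *)
  pose ok (x y : \bar R) := (0 <= x <= y)%E.
  suff /andP[] : ok (\prod_(i < n) \int[P]_w (f i (Z i w))%:E)%E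
    (\prod_(i < n) (if J i then expR e else 1)%:E)%E by [].
  apply: (big_ind2 ok) => [|x1 y1 x2 y2 /andP[? ?] /andP[? ?]|i _]; rewrite /ok.
  - by rewrite lexx lee01.
  - by rewrite mule_ge0//= lee_pmul.
  - by rewrite If andbT integral_ge0// => w _; rewrite lee_fin.
- by apply/measurable_EFinP.
- by move=> w _; rewrite lee_fin prodr_ge0.
Qed.

(** * Deviation bounds for noncentral chi-square sums *)

(** With p^2 = v := #|J| (1 + 2 b^2) and y^2 = x, the exponent to minimize is
    p^2 t^2 / (1 - 2 t) - 2 t p y - 2 t y^2, which at t = y / (p + 2 y) is
    exactly - y^2. *)
Lemma noncentral_chi2_upper_tail (d : measure_display) (T : measurableType d)
    (R : realType) (P : probability T R) (n : nat) (Z : 'I_n -> {RV P >-> R})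
    (J : pred 'I_n) (b x : R) (A : set T) :
  iid_std_normal Z -> (0 < #|J|)%N -> 0 < x -> measurable A ->
  (forall w, A w -> #|J|%:R * (1 + b ^+ 2)
      + 2 * Num.sqrt (#|J|%:R * (1 + 2 * b ^+ 2) * x) + 2 * x
    <= \sum_(i < n | J i) (Z i w + b) ^+ 2) ->
  (P A <= (expR (- x))%:E)%E.
Proof.
move=> ZN J0 x0 mA HA.
set m : R := #|J|%:R in HA *.
have m0 : 0 < m by rewrite ltr0n.
have v0 : 0 < m * (1 + 2 * b ^+ 2).
  by rewrite mulr_gt0//; have := sqr_ge0 b; lra.
pose p := Num.sqrt (m * (1 + 2 * b ^+ 2)); pose y := Num.sqrt x.
have p0 : 0 < p by rewrite sqrtr_gt0.
have y0 : 0 < y by rewrite sqrtr_gt0.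
have pE : p ^+ 2 = m * (1 + 2 * b ^+ 2) by rewrite sqr_sqrtr// ltW.
have yE : y ^+ 2 = x by rewrite sqr_sqrtr// ltW.
have pyE : Num.sqrt (m * (1 + 2 * b ^+ 2) * x) = p * y by rewrite sqrtrM// ltW.
pose t := y / (p + 2 * y).
have py0 : 0 < p + 2 * y by lra.
have t0 : 0 <= t by rewrite divr_ge0// ltW.
have t2 : t < 2^-1 by rewrite ltr_pdivrMr//; lra.
have tE : 1 - 2 * t = p / (p + 2 * y) by rewrite /t; field; lra.
pose u := m * (1 + b ^+ 2) + 2 * (p * y) + 2 * x.
pose e := t * (1 + b ^+ 2) + (1 + 2 * b ^+ 2) * (t ^+ 2 / (1 - 2 * t)).
have -> : - x = m * e - t * u.
  have -> : m * e = t * (m * (1 + b ^+ 2)) + p ^+ 2 * (t ^+ 2 / (1 - 2 * t)).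
    by rewrite pE /e; ring.
  rewrite tE /u -yE; rewrite /t; field; lra.
apply: (@chernoff_sum_sqr _ _ _ _ _ Z J t b (t * u) e) => //.
  by rewrite sqr_mgf_upper// t0.
by move=> w /HA; rewrite pyE => H; rewrite ler_wpM2l.
Qed.

(** Here the exponent is p^2 r^2 - 2 r p y, minimal at r = y / p. *)
Lemma noncentral_chi2_lower_tail (d : measure_display) (T : measurableType d)
    (R : realType) (P : probability T R) (n : nat) (Z : 'I_n -> {RV P >-> R})
    (J : pred 'I_n) (b x : R) (A : set T) :
  iid_std_normal Z -> (0 < #|J|)%N -> 0 < x -> measurable A ->
  (forall w, A w -> \sum_(i < n | J i) (Z i w + b) ^+ 2
    <= #|J|%:R * (1 + b ^+ 2) - 2 * Num.sqrt (#|J|%:R * (1 + 2 * b ^+ 2) * x)) ->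
  (P A <= (expR (- x))%:E)%E.
Proof.
move=> ZN J0 x0 mA HA.
set m : R := #|J|%:R in HA *.
have m0 : 0 < m by rewrite ltr0n.
have v0 : 0 < m * (1 + 2 * b ^+ 2).
  by rewrite mulr_gt0//; have := sqr_ge0 b; lra.
pose p := Num.sqrt (m * (1 + 2 * b ^+ 2)); pose y := Num.sqrt x.
have p0 : 0 < p by rewrite sqrtr_gt0.
have y0 : 0 < y by rewrite sqrtr_gt0.
have pE : p ^+ 2 = m * (1 + 2 * b ^+ 2) by rewrite sqr_sqrtr// ltW.
have yE : y ^+ 2 = x by rewrite sqr_sqrtr// ltW.
have pyE : Num.sqrt (m * (1 + 2 * b ^+ 2) * x) = p * y by rewrite sqrtrM// ltW.
pose r := y / p.
have r0 : 0 <= r by rewrite divr_ge0// ltW.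
pose u := m * (1 + b ^+ 2) - 2 * (p * y).
pose e := - r * (1 + b ^+ 2) + (1 + 2 * b ^+ 2) * r ^+ 2.
have -> : - x = m * e - (- r * u).
  have -> : m * e = - r * (m * (1 + b ^+ 2)) + p ^+ 2 * r ^+ 2.
    by rewrite pE /e; ring.
  by rewrite /u -yE /r; field; lra.
apply: (@chernoff_sum_sqr _ _ _ _ _ Z J (- r) b (- r * u) e) => //.
- lra.
- by rewrite sqr_mgf_lower.
- by move=> w /HA; rewrite pyE => H; rewrite !mulNr lerN2 ler_wpM2l.
Qed.

(** * The candidate intervals and the test *)

Definition candidate_itv {R : realType} (len : R) (j : nat) : set R :=
  `]j.-1%:R * len, j%:R * len]%classic.

Definition bump_statistic {R : realType} {n : nat} (sigma0 Delta sigma : R)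
    (I : set R) (y : 'I_n -> R) : R :=
  (sigma0 ^+ 2)^-1 * \sum_(i < n | design_point R i \in I)
    (y i + Delta / (sigma / sigma0) ^+ 2) ^+ 2.

(** In terms of the 0-based index [i], the condition is
    (j - 1) m <= i < j m, and j m <= n. *)
Lemma card_design_candidate (R : realType) (n m j : nat) (len : R) :
  (0 < n)%N -> 0 < len -> n%:R * len = m%:R ->
  (1 <= j)%N -> j%:R <= len^-1 ->
  #|[pred i : 'I_n | design_point R i \in candidate_itv len j]| = m.
Proof.
move=> n0 len0 nm j1 jlen.
have n0' : 0 < n%:R :> R by rewrite ltr0n.
have jmn : (j * m <= n)%N.
  rewrite -(ler_nat R) natrM -nm mulrCA -[leRHS]mulr1 ler_wpM2l//.
  by rewrite -ler_pdivlMr// div1r.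
have memE (i : 'I_n) : (design_point R i \in candidate_itv len j)
    = ((j.-1 * m <= i) && (i < j * m))%N.
  have E k : k%:R * len = (k * m)%:R / n%:R.
    by rewrite natrM -nm; field; rewrite gt_eqF.
  apply/idP/idP.
    rewrite inE /candidate_itv/= in_itv/= /design_point !E => /andP[].
    by rewrite ltr_pM2r ?invr_gt0// ler_pM2r ?invr_gt0// ltr_nat ler_nat ltnS => -> ->.
  move=> /andP[H1 H2].
  rewrite inE /candidate_itv/= in_itv/= /design_point !E.
  by rewrite ltr_pM2r ?invr_gt0// ler_pM2r ?invr_gt0// ltr_nat ler_nat ltnS H1 H2.
rewrite -sum1_card.
transitivity (\sum_(j.-1 * m <= i < n | (i < j * m)%N) 1)%N.
  by rewrite big_geq_mkord; apply: eq_bigl => i; rewrite inE memE andbC.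
rewrite -(big_nat_widen _ _ _ xpredT)// sum_nat_const_nat muln1.
by case: j j1 {jlen jmn memE} => // j _; rewrite mulSn addnK.
Qed.

Lemma candidate_intervalsE (R : realType) (len : R) (l : nat) :
  len^-1 = l%:R ->
  candidate_intervals len = [set candidate_itv len j.+1 | j in [set j | (j < l)%N]].
Proof.
move=> E; apply/seteqP; split => [I [j [j1 jl ->]]|_ [j /= jl] <-].
  by case: j j1 jl => // j _; rewrite E ler_nat => jl; exists j.
by exists j.+1; split => //; rewrite E ler_nat.
Qed.

(** The real supremum behaves as a least upper bound because the statistics of
    all intervals are bounded by the sum over all observations. *)
Lemma lr_testP (R : realType) (n : nat) (sigma0 Delta sigma len alpha : R)
    (y : 'I_n -> R) : 0 < len -> len <= 1 ->
  (lr_test sigma0 Delta sigma len alpha y <->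
   exists2 I, candidate_intervals len I &
     threshold n sigma0 Delta sigma len alpha
       < bump_statistic sigma0 Delta sigma I y).
Proof.
move=> len0 len1; rewrite /lr_test /scan_statistic.
set E := [set _ | _ in _]; set c := threshold _ _ _ _ _ _.
have E0 : E !=set0.
  exists (bump_statistic sigma0 Delta sigma (candidate_itv len 1) y).
  exists (candidate_itv len 1) => //; exists 1%N; split => //.
  by rewrite invf_ge1.
have ubE : has_ubound E.
  exists ((sigma0 ^+ 2)^-1 * \sum_(i < n) (y i + Delta / (sigma / sigma0) ^+ 2) ^+ 2).
  move=> _ [I _ <-]; rewrite ler_wpM2l ?invr_ge0 ?sqr_ge0//.
  rewrite big_mkcond; apply: ler_sum => i _.
  by case: ifP => // _; exact: sqr_ge0.
split.
  move=> /(sup_gt E0)[_ [I HI <-] cI]; by exists I.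
move=> [I HI cI]; apply: lt_le_trans cI _.
by apply: ub_le_sup => //; exists I.
Qed.

(** The threshold is the upper deviation point of [noncentral_chi2_upper_tail]
    for b = a and exp (- x) = alpha |I_n|. *)
Lemma thresholdE (R : realType) (n : nat) (sigma0 Delta sigma len alpha : R) :
  0 < sigma0 -> 0 < sigma -> 0 < len -> 0 < alpha ->
  let a := Delta * sigma0 / sigma ^+ 2 in
  let x := - ln (alpha * len) in
  threshold n sigma0 Delta sigma len alpha =
  n%:R * len * (1 + a ^+ 2)
    + 2 * Num.sqrt (n%:R * len * (1 + 2 * a ^+ 2) * x) + 2 * x.
Proof.
move=> s0 s1 l0 a0 a x.
have aE : Delta ^+ 2 / (sigma0 ^+ 2 * (sigma / sigma0) ^+ 4) = a ^+ 2.
  by rewrite /a; field; rewrite !gt_eqF.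
rewrite /threshold -mulrA aE ln_div ?posrE ?mulr_gt0// ln1 sub0r.
have -> : ln (alpha * len) = - x by rewrite opprK.
by clearbody x; rewrite opprK; ring.
Qed.

Lemma lr_reject_event (d : measure_display) (T : measurableType d)
    (R : realType) (n l : nat) (sigma0 Delta sigma len alpha : R)
    (Y : T -> 'I_n -> R) : 0 < len -> len <= 1 -> len^-1 = l%:R ->
  [set w | lr_test sigma0 Delta sigma len alpha (Y w) = true] =
  \big[setU/set0]_(j < l)
     [set w | threshold n sigma0 Delta sigma len alpha
        < bump_statistic sigma0 Delta sigma (candidate_itv len j.+1) (Y w)].
Proof.
move=> len0 len1 lE.
pose F j := [set w | threshold n sigma0 Delta sigma len alpha
  < bump_statistic sigma0 Delta sigma (candidate_itv len j.+1) (Y w)].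
rewrite -(bigcup_mkord _ F); apply/seteqP; split => w /=.
  move=> /(lr_testP _ _ _ _ _ _ _ _ len0 len1)[I].
  by rewrite (candidate_intervalsE _ _ _ lE) => -[j /= jl <-] H; exists j.
move=> [j /= jl H]; apply/(lr_testP _ _ _ _ _ _ _ _ len0 len1).
exists (candidate_itv len j.+1) => //.
by rewrite (candidate_intervalsE _ _ _ lE); exists j.
Qed.

Lemma measurable_bump_event (d : measure_display) (T : measurableType d)
    (R : realType) (P : probability T R) (n : nat) (Z : 'I_n -> {RV P >-> R})
    (mu lambda : R -> R) (sigma0 Delta sigma c : R) (I : set R) :
  measurable [set w | c < bump_statistic sigma0 Delta sigma I (hbr_obs Z mu lambda w)].
Proof.
have mS : measurable_fun setT
    (fun w => bump_statistic sigma0 Delta sigma I (hbr_obs Z mu lambda w)).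
  apply: measurable_funM => //.
  under eq_fun do rewrite big_mkcond/=.
  apply: measurable_sum => i; case: (design_point R i \in I) => //.
  apply: measurable_funX; apply: measurable_funD => //.
  apply: measurable_funD => //; apply: measurable_funM => //.
rewrite -[X in measurable X]setTI.
exact: (measurable_fun_ltr (measurable_cst c) mS).
Qed.

(** * Nonasymptotic bounds on the two errors *)

(** Each candidate contributes at most alpha |I_n| = exp (- x), the threshold
    being the upper deviation point of its statistic, and there are
    [l] = 1 / |I_n| of them. *)
Lemma type1_error_le (d : measure_display) (T : measurableType d)
    (R : realType) (P : probability T R) (n m l : nat) (Z : 'I_n -> {RV P >-> R})
    (sigma0 Delta sigma len alpha : R) :
  iid_std_normal Z -> (0 < n)%N -> 0 < sigma0 -> 0 < sigma ->
  0 < len -> len <= 1 -> 0 < alpha < 1 ->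
  n%:R * len = m%:R -> len^-1 = l%:R ->
  (type1_error Z sigma0 (lr_test sigma0 Delta sigma len alpha) <= alpha%:E)%E.
Proof.
move=> ZN n0 s0 s1 len0 len1 /andP[a0 a1] mE lE.
have m0 : (0 < m)%N by rewrite -(ltr_nat R) -mE mulr_gt0 ?ltr0n.
have al0 : 0 < alpha * len by exact: mulr_gt0.
have al1 : alpha * len < 1.
  by apply: le_lt_trans a1; rewrite ler_piMr// ltW.
rewrite /type1_error (lr_reject_event _ _ _ _ _ _ _ _ _ _ _ len0 len1 lE).
pose F j := [set w | threshold n sigma0 Delta sigma len alpha <
  bump_statistic sigma0 Delta sigma (candidate_itv len j.+1)
    (hbr_obs Z (@mu0 R) (lambda0 sigma0) w)].
apply: (le_trans (@Boole_inequality _ _ _ P F l _)).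
  by move=> j _; exact: measurable_bump_event.
apply: (@le_trans _ _ (\sum_(j < l) (alpha * len)%:E)%E); last first.
  rewrite sumEFin lee_fin sumr_const card_ord -[_ *+ _]mulr_natr -lE.
  by rewrite mulfK// gt_eqF.
apply: lee_sum => j _.
set J := [pred i : 'I_n | design_point R i \in candidate_itv len j.+1].
have JE : #|J| = m.
  by apply: card_design_candidate => //; rewrite lE ler_nat.
set x := - ln (alpha * len).
have x0 : 0 < x by rewrite oppr_gt0 ln_lt0// al0 al1.
have -> : alpha * len = expR (- x) by rewrite opprK lnK.
apply: (@noncentral_chi2_upper_tail _ _ _ _ _ Z J (Delta * sigma0 / sigma ^+ 2)) => //.
- by rewrite JE.
- exact: measurable_bump_event.
move=> w; rewrite /F/= thresholdE// JE mE -/x => /ltW H; apply: (le_trans H).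
rewrite le_eqVlt; apply/orP; left; apply/eqP.
rewrite /bump_statistic mulr_sumr; apply: eq_bigr => i _.
rewrite /hbr_obs /mu0 /lambda0; field.
by rewrite !gt_eqF.
Qed.

(** With p = sqrt (1 + 2 a^2), the difference of the two sides is
    u p (k u p - 2 y) + ((u a k)^2 - 2 y^2) - 2 z (1 + k) u p1,
    where p1 is the square root on the right. Since p >= sqrt 2 a, the
    hypothesis bounds the brackets below by sqrt 2 h and u a k h, where
    h = 2 z (1 + k), and p1 <= p + a k lets them absorb the last term. *)
Lemma power_margin (R : realType) (u a k y z : R) :
  0 <= u -> 0 <= a -> 0 <= k -> 0 <= y -> 0 <= z ->
  Num.sqrt 2 * y + 2 * z * (1 + k) <= u * a * k ->
  u ^+ 2 * (1 + a ^+ 2) + 2 * y ^+ 2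
    + 2 * (u * Num.sqrt (1 + 2 * a ^+ 2) * y)
  <= (1 + k) * (u ^+ 2 * (1 + a ^+ 2 * (1 + k))
    - 2 * (u * Num.sqrt (1 + 2 * (a ^+ 2 * (1 + k))) * z)).
Proof.
move=> u0 a0 k0 y0 z0 H.
set p := Num.sqrt (1 + 2 * a ^+ 2).
set p1 := Num.sqrt _.
have p0 : 0 <= p by exact: sqrtr_ge0.
have p10 : 0 <= p1 by exact: sqrtr_ge0.
have pE : p ^+ 2 = 1 + 2 * a ^+ 2 by rewrite sqr_sqrtr//; nra.
have p1E : p1 ^+ 2 = 1 + 2 * (a ^+ 2 * (1 + k)).
  by rewrite sqr_sqrtr//; have := sqr_ge0 a; nra.
set q := Num.sqrt 2 in H *.
have q0 : 0 <= q by exact: sqrtr_ge0.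
have qE : q ^+ 2 = 2 by rewrite sqr_sqrtr.
have qa_p : q * a <= p.
  by rewrite -(ler_pXn2r (n:=2))// ?nnegrE ?mulr_ge0// exprMn qE pE; lra.
have p1_le : p1 <= p + a * k.
  rewrite -(ler_pXn2r (n:=2))// ?nnegrE ?addr_ge0 ?mulr_ge0//.
  rewrite p1E sqrrD pE.
  have : 0 <= a * k * (p - a).
    apply: mulr_ge0; first exact: mulr_ge0.
    have : 1 <= q by rewrite -(ler_pXn2r (n:=2))// ?nnegrE ?ler01// qE expr1n; lra.
    nra.
  by have := sqr_ge0 (a * k); nra.
have uk0 : 0 <= u * k by exact: mulr_ge0.
set h := 2 * z * (1 + k) in H.
have h0 : 0 <= h by rewrite !mulr_ge0//; lra.
have kup : 2 * y + q * h <= k * u * p.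
  apply: le_trans (_ : q * (u * a * k) <= _); first by nra.
  by rewrite [leLHS](_ : _ = k * u * (q * a)); [rewrite ler_wpM2l// mulrC|ring].
have B1 : u * p * (q * h) <= u * p * (k * u * p - 2 * y).
  by rewrite ler_wpM2l ?mulr_ge0//; lra.
have B2 : h * (u * a * k) <= (u * a * k) ^+ 2 - 2 * y ^+ 2.
  have -> : (u * a * k) ^+ 2 - 2 * y ^+ 2 = (u * a * k - q * y) * (u * a * k + q * y).
    by rewrite -qE; ring.
  apply: ler_pM => //; first by rewrite !mulr_ge0.
    lra.
  by rewrite lerDl mulr_ge0.
have B3 : h * u * p1 <= u * p * (q * h) + h * (u * a * k).
  have hu0 : 0 <= h * u by exact: mulr_ge0.
  have q1 : 1 <= q by rewrite -(ler_pXn2r (n:=2))// ?nnegrE ?ler01// qE expr1n; lra.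
  have hup0 : 0 <= h * u * p by exact: mulr_ge0.
  have := ler_wpM2l hu0 p1_le.
  have := ler_wpM2l hup0 q1.
  by lra.
rewrite -subr_ge0.
have -> : (1 + k) * (u ^+ 2 * (1 + a ^+ 2 * (1 + k)) - 2 * (u * p1 * z))
   - (u ^+ 2 * (1 + a ^+ 2) + 2 * y ^+ 2 + 2 * (u * p * y))
   = u * p * (k * u * p - 2 * y) + ((u * a * k) ^+ 2 - 2 * y ^+ 2) - h * u * p1.
  have -> : u * p * (k * u * p - 2 * y) = k * u ^+ 2 * p ^+ 2 - 2 * (u * p * y) by ring.
  by rewrite pE /h; ring.
lra.
Qed.

(** Accepting implies that the statistic of the interval carrying the bump,
    (1 + k) times a noncentral chi-square variable, is at most the threshold,
    which [power_margin] places below its lower deviation point. *)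
Lemma type2_error_le (d : measure_display) (T : measurableType d)
    (R : realType) (P : probability T R) (n m l : nat) (Z : 'I_n -> {RV P >-> R})
    (sigma0 Delta sigma len alpha : R) :
  iid_std_normal Z -> (0 < n)%N -> 0 < sigma0 -> 0 < sigma -> 0 < Delta ->
  0 < len -> len <= 1 -> 0 < alpha < 1 ->
  n%:R * len = m%:R -> len^-1 = l%:R ->
  Num.sqrt 2 * Num.sqrt (- ln (alpha * len))
    + 2 * Num.sqrt (- ln alpha) * (1 + (sigma / sigma0) ^+ 2)
  <= Num.sqrt m%:R * (Delta / sigma0) ->
  (type2_error Z sigma0 Delta sigma len (lr_test sigma0 Delta sigma len alpha)
    <= alpha%:E)%E.
Proof.
move=> ZN n0 s0 s1 D0 len0 len1 /andP[a0 a1] mE lE Hpower.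
have m0 : (0 < m)%N by rewrite -(ltr_nat R) -mE mulr_gt0 ?ltr0n.
have al0 : 0 < alpha * len by exact: mulr_gt0.
have al1 : alpha * len < 1.
  by apply: le_lt_trans a1; rewrite ler_piMr// ltW.
apply: ge_ereal_sup => _ [_ [j [j1 jlen ->]] <-].
rewrite -/(candidate_itv len j); set I := candidate_itv len j.
set J := [pred i : 'I_n | design_point R i \in I].
have JE : #|J| = m by exact: card_design_candidate.
have z0 : 0 < - ln alpha by rewrite oppr_gt0 ln_lt0// a0.
rewrite [leRHS](_ : _ = (expR (- - ln alpha))%:E); last by rewrite opprK lnK.
pose k := (sigma / sigma0) ^+ 2.
have kgt0 : 0 < k by rewrite exprn_gt0// divr_gt0.
have k0 := ltW kgt0.
pose a := Delta * sigma0 / sigma ^+ 2.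
have ak : a * k = Delta / sigma0 by rewrite /a /k; field; rewrite !gt_eqF.
pose s := Num.sqrt (sigma0 ^+ 2 + sigma ^+ 2).
have s2 : s ^+ 2 = sigma0 ^+ 2 * (1 + k).
  rewrite sqr_sqrtr ?addr_ge0 ?sqr_ge0//.
  by rewrite /k; field; rewrite gt_eqF.
have sgt0 : 0 < s by rewrite sqrtr_gt0 addr_gt0// exprn_gt0.
pose b := (Delta + Delta / k) / s.
have b2 : b ^+ 2 = a ^+ 2 * (1 + k).
  have -> : a = Delta / sigma0 / k by rewrite -ak mulfK// gt_eqF.
  rewrite /b exprMn exprVn s2; clearbody k; field.
  by rewrite !gt_eqF// addr_gt0.
apply: (@noncentral_chi2_lower_tail _ _ _ _ _ Z J b) => //.
- by rewrite JE.
- rewrite (_ : mkset _ = ~` [set w | lr_test sigma0 Delta sigma len alpha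
     (hbr_obs Z (mu1 Delta I) (lambda1 sigma0 sigma I) w) = true]).
    rewrite (lr_reject_event _ _ _ _ _ _ _ _ _ _ _ len0 len1 lE).
    apply: measurableC; apply: bigsetU_measurable => i _.
    exact: measurable_bump_event.
  by apply/seteqP; split => w /=; [move=> ->|case: lr_test => // /(_ erefl)].
move=> w /= /negbT Hw.
have {}Hw : bump_statistic sigma0 Delta sigma I
    (hbr_obs Z (mu1 Delta I) (lambda1 sigma0 sigma I) w)
    <= threshold n sigma0 Delta sigma len alpha.
  rewrite leNgt; apply: contra Hw => Hw.
  by apply/(lr_testP _ _ _ _ _ _ _ _ len0 len1); exists I => //; exists j.
have SE : bump_statistic sigma0 Delta sigma I
    (hbr_obs Z (mu1 Delta I) (lambda1 sigma0 sigma I) w)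
    = (1 + k) * \sum_(i < n | J i) (Z i w + b) ^+ 2.
  rewrite /bump_statistic !mulr_sumr; apply: eq_bigr => i iI.
  rewrite /hbr_obs /mu1 /lambda1 indicE iI !mulr1 -/s -/k.
  have -> : Delta + s * Z i w + Delta / k = s * (Z i w + b).
    by rewrite /b; field; rewrite !gt_eqF.
  by rewrite exprMn s2; field; rewrite gt_eqF.
rewrite JE b2 -(ler_pM2l (_ : 0 < 1 + k)); last by lra.
rewrite -SE; apply: (le_trans Hw).
rewrite thresholdE// mE -/a; set x := - ln (alpha * len).
have x0 : 0 <= x by rewrite oppr_ge0 ltW// ln_lt0// al0 al1.
have mR0 : 0 <= m%:R :> R by exact: ler0n.
have sqrt3 (p q : R) : 0 <= p -> Num.sqrt (m%:R * p * q) =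
    Num.sqrt m%:R * Num.sqrt p * Num.sqrt q.
  by move=> p0; rewrite !sqrtrM ?mulr_ge0.
have a20 : 0 <= a ^+ 2 by exact: sqr_ge0.
rewrite !sqrt3; [|by nra|by lra].
have := @power_margin R (Num.sqrt m%:R) a k (Num.sqrt x) (Num.sqrt (- ln alpha)).
rewrite !sqr_sqrtr// ?(ltW z0)//.
rewrite !sqrtr_ge0 k0 -(mulrA _ a k) ak.
have -> : 0 <= a by rewrite divr_ge0 ?sqr_ge0// mulr_ge0// ltW.
move=> /(_ isT isT isT isT isT Hpower).
by rewrite addrAC; move/le_trans; apply.
Qed.

(** * Asymptotics *)

Lemma limn_esup_le_near (R : realType) (u : nat -> \bar R) (l : \bar R) :
  (\forall n \near \oo, u n <= l)%E -> (limn_esup u <= l)%E.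
Proof.
move=> ul; apply: (@le_trans _ _ (ereal_sup (u @` [set n | (u n <= l)%E]))).
  by apply: ereal_inf_lbound; exists [set n | (u n <= l)%E].
by apply: ge_ereal_sup => _ [n /= ? <-].
Qed.

Lemma sqrtrD_le (R : realType) (x y : R) : 0 <= x -> 0 <= y ->
  Num.sqrt (x + y) <= Num.sqrt x + Num.sqrt y.
Proof.
move=> x0 y0; rewrite -(ler_pXn2r (n:=2))// ?nnegrE ?addr_ge0 ?sqrtr_ge0//.
rewrite sqrrD !sqr_sqrtr ?addr_ge0//.
have : 0 <= Num.sqrt x * Num.sqrt y by rewrite mulr_ge0 ?sqrtr_ge0.
by lra.
Qed.

(** Half of the margin eps sqrt L pays for the terms proportional to eps, the
    other half for the constant ones. *)
Lemma detection_margin (R : realType) (sigma0 k C l L eps A : R) :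
  0 < sigma0 -> 0 < C -> 0 <= l -> 0 <= L -> 0 < eps ->
  k <= C * (1 + eps) ->
  4 * Num.sqrt l * C * sigma0 <= Num.sqrt L ->
  2 * sigma0 * Num.sqrt l * (Num.sqrt 2 + 2 + 2 * C) <= eps * Num.sqrt L ->
  (Num.sqrt 2 * sigma0 + eps) * Num.sqrt L <= A ->
  Num.sqrt 2 * Num.sqrt (l + L) + 2 * Num.sqrt l * (1 + k) <= A / sigma0.
Proof.
move=> s0 C0 l0 L0 e0 kC H1 H2 H3.
have := sqrtrD_le _ _ _ l0 L0.
set z := Num.sqrt l in H1 H2 *; set y := Num.sqrt L in H1 H2 H3 *.
set q := Num.sqrt 2 in H2 H3 *; set w := Num.sqrt _ => wzy.
have z0 : 0 <= z by exact: sqrtr_ge0.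
have q0 : 0 <= q by exact: sqrtr_ge0.
rewrite ler_pdivlMr//; apply: le_trans H3.
have B1 : q * w * sigma0 <= q * (z + y) * sigma0.
  by rewrite ler_wpM2r ?(ltW s0)// ler_wpM2l.
have B2 : 2 * z * k * sigma0 <= 2 * z * (C * (1 + eps)) * sigma0.
  by rewrite ler_wpM2r ?(ltW s0)// ler_wpM2l// mulr_ge0.
have B3 : eps * (4 * z * C * sigma0) <= eps * y by rewrite ler_wpM2l// ltW.
lra.
Qed.

Lemma littleo_near_le (R : realType) (h eps : nat -> R) :
  (forall n, 0 < eps n) -> h =o_\oo eps -> \forall n \near \oo, h n <= eps n.
Proof.
move=> e0 /eqoP/(_ 1 ltr01); apply: filterS => n.
by rewrite mul1r (gtr0_norm (e0 n)); apply: le_trans; exact: ler_norm.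
Qed.

Theorem theorem5p1 (R : realType)
  (d : nat -> measure_display)
  (Omega : forall n : nat, measurableType (d n))
  (P : forall n : nat, probability (Omega n) R)
  (Z : forall n : nat, 'I_n -> {RV (P n) >-> R})
  (sigma0 : R) (Delta sigma len eps : nat -> R) (alpha : R)
  (HZ : forall n : nat, iid_std_normal (Z n))
  (sigma0_gt0 : 0 < sigma0)
  (Delta_gt0 : forall n : nat, 0 < Delta n)
  (sigma_gt0 : forall n : nat, 0 < sigma n)
  (len_gt0 : forall n : nat, 0 < len n)
  (len_le1 : forall n : nat, len n <= 1)
  (len_inv_nat : forall n : nat, (len n)^-1 \is a Num.nat)
  (n_len_nat : forall n : nat, n%:R * len n \is a Num.nat)
  (len_cvg0 : len n @[n --> \oo] --> 0)
  (eps_gt0 : forall n : nat, 0 < eps n)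
  (eps_cvg : eps n * Num.sqrt (- ln (len n)) @[n --> \oo] --> +oo)
  (alpha_gt0 : 0 < alpha) (alpha_lt1 : alpha < 1)
  (Hregime :
    (sigma n ^+ 2 / Delta n @[n --> \oo] --> 0
     /\ (fun n : nat => sigma n ^+ 2) =o_\oo eps)
    \/
    (sigma n ^+ 2 / Delta n @[n --> \oo] --> 0
     /\ exists sigmabar : R, 0 < sigmabar /\
        exists2 h : nat -> R, h =o_\oo eps &
          forall n : nat, sigma n ^+ 2 = sigmabar ^+ 2 * (1 + h n)))
  (Hdetect : exists N : nat, forall n : nat, (N <= n)%N ->
    (Num.sqrt 2 * sigma0 + eps n) * Num.sqrt (- ln (len n))
      <= Num.sqrt (n%:R * len n) * Delta n) :
  let Phi := fun n : nat =>
    @lr_test R n sigma0 (Delta n) (sigma n) (len n) alpha in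
  (limn_esup (fun n : nat => type1_error (Z n) sigma0 (Phi n)) <= alpha%:E)%E
  /\
  (limn_esup (fun n : nat =>
     type2_error (Z n) sigma0 (Delta n) (sigma n) (len n) (Phi n))
     <= alpha%:E)%E.
Proof.
move=> Phi.
(* As eps_n may be unbounded, sigma_n^2 is controlled by a multiple of
   1 + eps_n rather than by a constant. *)
have [C C0 HC] : exists2 C : R, 0 < C &
    \forall n \near \oo, sigma n ^+ 2 <= sigma0 ^+ 2 * (C * (1 + eps n)).
  have s20 : 0 < sigma0 ^+ 2 by rewrite exprn_gt0.
  case: Hregime => [[_ H]|[_ [sb [sb0 [h Hh sE]]]]].
    exists (sigma0 ^+ 2)^-1; first by rewrite invr_gt0.
    have := littleo_near_le _ _ _ eps_gt0 H; apply: filterS => n Hn.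
    by rewrite mulrA divff ?gt_eqF// mul1r; lra.
  exists (sb ^+ 2 / sigma0 ^+ 2); first by rewrite divr_gt0// exprn_gt0.
  have := littleo_near_le _ _ _ eps_gt0 Hh; apply: filterS => n Hn.
  rewrite sE mulrA [sigma0 ^+ 2 * _]mulrC divfK ?gt_eqF//.
  by rewrite ler_wpM2l ?sqr_ge0// lerD2l.
have a01 : 0 < alpha < 1 by rewrite alpha_gt0.
(* The levels that sqrt (- ln |I_n|) and eps_n sqrt (- ln |I_n|) have to reach
   in [detection_margin]. *)
pose M1 := 4 * Num.sqrt (- ln alpha) * C * sigma0.
pose M2 := 2 * sigma0 * Num.sqrt (- ln alpha) * (Num.sqrt 2 + 2 + 2 * C).
have M10 : 0 <= M1 by rewrite !mulr_ge0 ?sqrtr_ge0// ltW.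
have [N HN] := Hdetect.
split; apply: limn_esup_le_near; near=> n.
- have n0 : (0 < n)%N by near: n; exact: nbhs_infty_gt.
  have /natrP[m mE] := n_len_nat n; have /natrP[l lE] := len_inv_nat n.
  by apply: (@type1_error_le _ _ _ _ n m l).
- have n0 : (0 < n)%N by near: n; exact: nbhs_infty_gt.
  have /natrP[m mE] := n_len_nat n; have /natrP[l lE] := len_inv_nat n.
  apply: (@type2_error_le _ _ _ _ n m l) => //.
  have L0 : 0 <= - ln (len n) by rewrite oppr_ge0 ln_le0.
  have -> : - ln (alpha * len n) = - ln alpha + - ln (len n).
    by rewrite lnM ?posrE// opprD.
  rewrite mulrA; apply: (@detection_margin _ _ _ C _ _ (eps n)) => //.
  + by rewrite oppr_ge0 ln_le0// ltW.
  + rewrite expr_div_n ler_pdivrMr ?exprn_gt0// mulrC.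
    by near: n.
  + rewrite -/M1 -(ler_pXn2r (n:=2))// ?nnegrE ?sqrtr_ge0// sqr_sqrtr//.
    rewrite lerNr -[leRHS]expRK ler_ln ?posrE ?expR_gt0//.
    near: n; apply: (cvgr_le _ len_cvg0); exact: expR_gt0.
  + rewrite -/M2; near: n.
    by move/cvgryPge : eps_cvg; apply.
  + by rewrite -mE; apply: HN; near: n; exact: nbhs_infty_ge.
Unshelve. all: by end_near. Qed.
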